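(* Let $G$ be a connected graph. Then $G$ has a normal spanning tree if and only if its vertex set $V(G)$ is a countable union of $TK^{\aleph_0}$-dispersed sets, i.e.\ there exist sets $V_n \subseteq V(G)$, $n \in \mathbb{N}$, with $V(G) = \bigcup_{n \in \mathbb{N}} V_n$, such that each $V_n$ is $TK^{\aleph_0}$-dispersed in $G$.
   Context: Graphs may be infinite (of arbitrary cardinality). For a tree $T$ with root $r$, the tree-order $\leq_T$ is defined by $u \leq_T v$ if $u$ lies on the unique path from $r$ to $v$ in $T$. A rooted spanning tree $T$ of $G$ is normal if the end vertices of every edge of $G$ are comparable in $\leq_T$. A subdivided infinite clique in $G$ is a subgraph of $G$ that is a subdivision of the complete graph on countably infinitely many vertices. A set $U \subseteq V(G)$ is $TK^{\aleph_0}$-dispersed in $G$ if for every subdivided infinite clique $K \subseteq G$ there is a finite set $F \subseteq V(G)$ separating $U$ from $K$ (i.e.\ every path in $G$ from $U$ to $K$ meets $F$). *)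

(* Defs.v *)
(* graphs of arbitrary cardinality as a symmetric irreflexive
   relation on an arbitrary Type. *)
From Stdlib Require Import List.
Import ListNotations.
Set Implicit Arguments.

Section Graphs.
Variable V : Type.

Fixpoint chain (e : V -> V -> Prop) (l : list V) : Prop :=
  match l with
  | x :: ((y :: _) as l') => e x y /\ chain e l'
  | _ => True
  end.

Definition is_path (e : V -> V -> Prop) (a b : V) (p : list V) : Prop :=
  NoDup p /\ chain e p /\ hd_error p = Some a /\ last p a = b.

Definition connected (e : V -> V -> Prop) : Prop :=
  (exists v : V, True) /\ forall a b : V, exists p, is_path e a b p.

Definition is_cycle (e : V -> V -> Prop) (c : list V) : Prop :=
  3 <= length c /\ NoDup c /\ chain e c /\
  exists x y, hd_error c = Some x /\ last c x = y /\ e y x.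

Definition acyclic (e : V -> V -> Prop) : Prop :=
  forall c, ~ is_cycle e c.

Definition spanning_tree (adj t : V -> V -> Prop) : Prop :=
  (forall x y, t x y -> adj x y) /\ (forall x y, t x y -> t y x) /\
  connected t /\ acyclic t.

Definition tree_le (t : V -> V -> Prop) (r u v : V) : Prop :=
  exists p, is_path t r v p /\ In u p.

Definition normal_spanning_tree (adj t : V -> V -> Prop) (r : V) : Prop :=
  spanning_tree adj t /\
  forall x y, adj x y -> tree_le t r x y \/ tree_le t r y x.

Definition has_normal_spanning_tree (adj : V -> V -> Prop) : Prop :=
  exists t r, normal_spanning_tree adj t r.

(* K (as a vertex set) is the vertex set of a subdivided infinite clique in G:
   injective branch vertices b i (i : nat), paths P i j (i < j) in G from b i
   to b j, internally disjoint and avoiding other branch vertices internally. *)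
Definition subdivided_inf_clique (adj : V -> V -> Prop) (K : V -> Prop) : Prop :=
  exists (b : nat -> V) (P : nat -> nat -> list V),
    (forall i j, b i = b j -> i = j) /\
    (forall i j, i < j -> is_path adj (b i) (b j) (P i j)) /\
    (forall i j m, i < j -> In (b m) (P i j) -> m = i \/ m = j) /\
    (forall i j k l x, i < j -> k < l -> (i, j) <> (k, l) ->
        In x (P i j) -> In x (P k l) ->
        (x = b i \/ x = b j) /\ (x = b k \/ x = b l)) /\
    (forall x, K x <-> exists i j, i < j /\ In x (P i j)).

Definition separates (adj : V -> V -> Prop) (F : list V) (U K : V -> Prop) : Prop :=
  forall a c p, U a -> K c -> is_path adj a c p -> exists f, In f F /\ In f p.

Definition TK_dispersed (adj : V -> V -> Prop) (U : V -> Prop) : Prop :=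
  forall K, subdivided_inf_clique adj K ->
    exists F : list V, separates adj F U K.

End Graphs.

(* Main.v *)
Require Import Defs.
From Stdlib Require Import List Arith Lia Cantor FinFun.
From Stdlib Require Import ClassicalEpsilon FunctionalExtensionality PropExtensionality.
Import ListNotations.
Set Implicit Arguments.

(** Given a normal spanning tree, its levels are dispersed: as finitely many vertices cannot
    separate two branch vertices of a subdivided clique, for each [n] there is a vertex [x] of level
    [n + 1] comparable to all branch vertices. The only clique vertices that lie neither above nor
    below [x] are on clique paths that meet the set of vertices below [x] twice. As two vertices lie
    on at most one common clique path, there are finitely many of these; together with the vertices
    below [x], they separate the clique from level [n].

    Conversely, let [V] be the union of dispersed sets [Vn]. Grow normal trees [T_0, T_1, ...]: for
    every component [D] of [G - T_n] add a path in [D] hanging from the largest neighbour of [D] in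
    [T_n] and ending at a target. The targets are scheduled so that, as long as [D] contains
    vertices of [Vn k], or neighbours of a given tree vertex [x], one of those is reached infinitely
    often. If a component [C] of the complement of the union survives, then its neighbourhood is
    infinite (else [C] would be a component of some [G - T_n] and the tree would have grown into
    it), and the disjoint, consecutively linked paths [P_n] grown in the components containing [C]
    connect any two neighbours of [C] even after the removal of finitely many vertices. Hence there
    is a subdivided clique with branch vertices in the neighbourhood of [C], which no finite set
    separates from the [P_n], nor therefore from any [Vn k] that meets [C]. *)

(** * Lists and sequences *)

Lemma course_of_values_choice (A : Type) (a0 : A) (R : nat -> (nat -> A) -> A -> Prop) :
  (forall n f g a, (forall k, k < n -> f k = g k) -> R n f a -> R n g a) ->
  (forall n f, (forall k, k < n -> R k f (f k)) -> exists a, R n f a) ->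
  exists f, forall n, R n f (f n).
Proof.
  intros local step.
  assert (next : forall nf : nat * (nat -> A), exists a,
    (forall k, k < fst nf -> R k (snd nf) (snd nf k)) -> R (fst nf) (snd nf) a).
  { intros [n f]. destruct (classic (forall k, k < n -> R k f (f k))) as [Hf|Hf].
    - destruct (step n f Hf) as [a Ha]. now exists a.
    - now exists a0. }
  destruct (choice _ next) as [g Hg].
  pose (prefix := fix prefix n := match n with
    | 0 => fun _ => a0
    | S m => fun k => if k =? m then g (m, prefix m) else prefix m k
    end).
  pose (f := fun n => g (n, prefix n)).
  assert (prefix_eq : forall n k, k < n -> prefix n k = f k).
  { induction n as [|n IH]; intros k Hk; [lia|]. simpl.
    destruct (Nat.eqb_spec k n) as [->|]; [easy|]. apply IH; lia. }
  exists f. intros n; induction n as [n IH] using lt_wf_ind.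
  apply local with (prefix n); [apply prefix_eq|].
  apply (Hg (n, prefix n)); simpl. intros k Hk. rewrite prefix_eq by easy.
  apply local with f; [|now apply IH].
  intros j Hj; symmetry; apply prefix_eq; lia.
Qed.

Lemma eventually_forall_in (A : Type) (Q : nat -> A -> Prop) (l : list A) :
  (forall a, In a l -> exists N, forall n, N <= n -> Q n a) ->
  exists N, forall n a, N <= n -> In a l -> Q n a.
Proof.
  induction l as [|a l IH]; intros H.
  - exists 0; intros n a _ [].
  - destruct (H a (or_introl eq_refl)) as [M Ha].
    destruct IH as [N Hl]; [intros b Hb; apply H; now right|].
    exists (M + N); intros n b Hn [<-|Hb]; [apply Ha|apply Hl]; auto; lia.
Qed.

Lemma finite_cover (A B : Type) (R : B -> A -> Prop) :
  (forall b, exists l, forall a, R b a -> In a l) ->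
  forall L, exists l, forall b a, In b L -> R b a -> In a l.
Proof.
  intros H L; destruct (choice _ H) as [g Hg].
  exists (flat_map g L); intros b a Hb Hab. apply in_flat_map; eauto.
Qed.

Definition infinite (A : Type) (X : A -> Prop) : Prop :=
  forall l : list A, exists x, X x /\ ~ In x l.

Lemma Injective_range_infinite (A : Type) (f : nat -> A) :
  Injective f -> infinite (fun x => exists n, x = f n).
Proof.
  intros f_inj l. apply NNPP; intros no_fresh.
  assert (I : incl (map f (seq 0 (S (length l)))) l).
  { intros x Hx. apply in_map_iff in Hx as (i & <- & _).
    apply NNPP; intros Hi; apply no_fresh; eauto. }
  apply NoDup_incl_length in I.
  - rewrite length_map, length_seq in I; lia.
  - apply Injective_map_NoDup; [exact f_inj|apply seq_NoDup].
Qed.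

Lemma NoDup_app_disjoint (A : Type) (l l' : list A) (a : A) :
  NoDup (l ++ l') -> In a l -> ~ In a l'.
Proof.
  intros N Ha Ha'. apply in_split in Ha as (l1 & l2 & ->).
  rewrite <- app_assoc in N. apply NoDup_remove_2 in N. apply N.
  rewrite !in_app_iff; auto.
Qed.

Lemma split_first (A : Type) (Q : A -> Prop) (l : list A) :
  (exists x, In x l /\ Q x) ->
  exists l1 x l2, l = l1 ++ x :: l2 /\ Q x /\ forall y, In y l1 -> ~ Q y.
Proof.
  induction l as [|a l IH]; intros (x & Hx & Qx); [easy|].
  destruct (classic (Q a)) as [Qa|Qa]; [now exists [], a, l|].
  destruct IH as (l1 & y & l2 & -> & Qy & H).
  { exists x; split; auto. destruct Hx as [<-|]; tauto. }
  exists (a :: l1), y, l2. split; [easy|split; [easy|]]. intros z [<-|Hz]; auto.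
Qed.

Lemma split_order (A : Type) (l : list A) (x y : A) :
  In x l -> In y l ->
  (exists l1 l2, l = l1 ++ x :: l2 /\ In y (x :: l2)) \/
  (exists l1 l2, l = l1 ++ y :: l2 /\ In x (y :: l2)).
Proof.
  intros Hx Hy. apply in_split in Hx as (l1 & l2 & ->).
  apply in_app_iff in Hy as [Hy|Hy]; [right|left; now exists l1, l2].
  apply in_split in Hy as (l0 & l3 & ->). exists l0, (l3 ++ x :: l2).
  rewrite <- app_assoc. split; [easy|]. right; apply in_elt.
Qed.

(** * Walks and paths *)

Section Walks.
Variable V : Type.
Variable e : V -> V -> Prop.

Inductive reach (A : V -> Prop) : V -> V -> Prop :=
| reach_refl x : A x -> reach A x x
| reach_cons x y z : A x -> e x y -> reach A y z -> reach A x z.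

Lemma reach_left A x y : reach A x y -> A x.
Proof. now destruct 1. Qed.

Lemma reach_right A x y : reach A x y -> A y.
Proof. now induction 1. Qed.

Lemma reach_trans A x y z : reach A x y -> reach A y z -> reach A x z.
Proof. induction 1; eauto using reach_cons. Qed.

Lemma reach_snoc A x y z : reach A x y -> e y z -> A z -> reach A x z.
Proof.
  intros xy yz Az. apply reach_trans with y; [exact xy|].
  apply reach_cons with z; [exact (reach_right xy)|exact yz|now apply reach_refl].
Qed.

Lemma reach_sub (A B : V -> Prop) x y :
  (forall z, A z -> B z) -> reach A x y -> reach B x y.
Proof. intros AB; induction 1; eauto using reach_refl, reach_cons. Qed.

Lemma reach_exit (A B : V -> Prop) x w :
  reach A x w -> B x -> ~ B w ->
  exists y z, reach (fun v => A v /\ B v) x y /\ e y z /\ A z /\ ~ B z.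
Proof.
  induction 1 as [x Ax|x y w Ax xy yw IH]; intros Bx Bw; [contradiction|].
  destruct (classic (B y)) as [By|By].
  - destruct (IH By Bw) as (u & z & xu & uz); exists u, z; split; [|easy].
    now apply reach_cons with y.
  - exists x, y; split; [now apply reach_refl|]. now apply reach_left in yw.
Qed.

Lemma reach_invariant (A B : V -> Prop) x y :
  (forall u v, A u -> A v -> e u v -> B u -> B v) -> reach A x y -> B x -> B y.
Proof.
  intros inv; induction 1 as [|x y z Ax xy yz IH]; auto.
  intros Bx; apply IH; apply inv with x; auto. now apply reach_left in yz.
Qed.

Lemma chain_reach (A : V -> Prop) x l :
  chain e (x :: l) -> (forall z, In z (x :: l) -> A z) ->
  forall y, In y (x :: l) -> reach A x y.
Proof.
  revert x; induction l as [|u l IH]; intros x.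
  - intros _ HA y [<-|[]]; apply reach_refl; apply HA; now left.
  - intros [xu C] HA y [<-|Hy]; [apply reach_refl; apply HA; now left|].
    apply reach_cons with u; auto; [apply HA; now left|].
    apply IH; auto. intros z Hz; apply HA; now right.
Qed.

Lemma chain_app_r l l' : chain e (l ++ l') -> chain e l'.
Proof.
  induction l as [|x l IH]; auto; intros H; apply IH.
  simpl in H; destruct (l ++ l'); simpl; tauto.
Qed.

Lemma chain_app_l l l' : chain e (l ++ l') -> chain e l.
Proof.
  induction l as [|x l IH]; simpl; auto; intros H.
  destruct l as [|y l]; simpl; auto.
  destruct H as [xy H]; split; [exact xy|]. now apply IH.
Qed.

Lemma chain_app l x l' : chain e (l ++ [x]) -> chain e (x :: l') -> chain e (l ++ x :: l').
Proof.
  intros C C'; induction l as [|y l IH]; auto.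
  destruct l as [|z l]; [split; [apply C|exact C']|].
  destruct C as [yz C]; split; [exact yz|]. now apply IH.
Qed.

Lemma is_path_ends a b p :
  is_path e a b p <->
  NoDup p /\ chain e p /\ (exists l, p = a :: l) /\ (exists l, p = l ++ [b]).
Proof.
  split.
  - intros (N & C & H & L). split; [exact N|split; [exact C|]].
    destruct p as [|x p]; [easy|]. injection H as ->. split; [now exists p|].
    destruct (@exists_last _ (a :: p)) as (l & z & E); [easy|].
    exists l. rewrite E, last_last in L. congruence.
  - intros (N & C & [l Ha] & [l' Hb]). split; [exact N|split; [exact C|split]].
    + now rewrite Ha.
    + now rewrite Hb, last_last.
Qed.

Lemma path_head a b p : is_path e a b p -> exists l, p = a :: l.
Proof. now intros (_ & _ & H & _)%is_path_ends. Qed.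

Lemma path_head_in a b p : is_path e a b p -> In a p.
Proof. intros [l ->]%path_head; now left. Qed.

Lemma path_last_in a b p : is_path e a b p -> In b p.
Proof. intros (_ & _ & _ & [l ->])%is_path_ends. apply in_elt. Qed.

Lemma path_refl x : is_path e x x [x].
Proof.
  apply is_path_ends. repeat split; [repeat constructor; easy|now exists []|now exists []].
Qed.

Lemma path_suffix a b l x l' : is_path e a b (l ++ x :: l') -> is_path e x b (x :: l').
Proof.
  rewrite !is_path_ends. intros (N & C & _ & [m E]). repeat split.
  - now apply NoDup_app_remove_l in N.
  - now apply chain_app_r in C.
  - now exists l'.
  - destruct (@exists_last _ (x :: l')) as (m' & z & E'); [easy|].
    exists m'. rewrite E', app_assoc in E. apply app_inj_tail in E as [_ ->]. exact E'.
Qed.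

Lemma path_prefix a b l x l' : is_path e a b (l ++ x :: l') -> is_path e a x (l ++ [x]).
Proof.
  rewrite !is_path_ends. change (x :: l') with ([x] ++ l'). rewrite app_assoc.
  intros (N & C & [m E] & _). repeat split.
  - now apply NoDup_app_remove_r in N.
  - now apply chain_app_l in C.
  - destruct l as [|y l]; injection E as -> _; [now exists []|now exists (l ++ [x])].
  - now exists l.
Qed.

Lemma path_cons a b c p :
  e a b -> is_path e b c p -> ~ In a p -> is_path e a c (a :: p).
Proof.
  rewrite !is_path_ends. intros ab (N & C & [l ->] & [l' E]) Ha. repeat split.
  - now constructor.
  - exact ab.
  - exact C.
  - now exists (b :: l).
  - exists (a :: l'). now rewrite E.
Qed.

Lemma path_loop x p : is_path e x x p -> p = [x].
Proof.
  intros (N & _ & [l ->] & [l' E])%is_path_ends.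
  destruct l' as [|y l']; injection E as ->; [now subst|].
  inversion_clear N as [|? ? Nx _]. elim Nx. subst l; apply in_elt.
Qed.

Lemma reach_path A x y :
  reach A x y -> exists p, is_path e x y p /\ forall z, In z p -> A z.
Proof.
  induction 1 as [x Ax|x y z Ax xy yz (p & Hp & HA)].
  - exists [x]; split; [apply path_refl|]. now intros z [<-|[]].
  - destruct (classic (In x p)) as [Hx|Hx].
    + apply in_split in Hx as (l & l' & ->).
      exists (x :: l'); split; [exact (path_suffix _ _ _ Hp)|].
      intros w Hw; apply HA; apply in_or_app; now right.
    + exists (x :: p); split; [now apply path_cons with y|].
      intros w [<-|Hw]; auto.
Qed.

Lemma path_reach (A : V -> Prop) x y p :
  is_path e x y p -> (forall z, In z p -> A z) -> reach A x y.
Proof.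
  intros Hp HA. pose proof (path_last_in Hp) as Hy.
  destruct (path_head Hp) as [l ->]. apply chain_reach with l; auto. apply Hp.
Qed.

Hypothesis e_sym : forall x y, e x y -> e y x.

Lemma reach_sym A x y : reach A x y -> reach A y x.
Proof. induction 1; eauto using reach_refl, reach_snoc. Qed.

Lemma chain_rev l : chain e l -> chain e (rev l).
Proof.
  induction l as [|x l IH]; simpl; auto.
  destruct l as [|y l]; simpl; auto.
  intros [xy C]. specialize (IH C). simpl in IH.
  rewrite <- app_assoc; simpl. apply chain_app; [exact IH|]; simpl; auto.
Qed.

Lemma path_rev a b p : is_path e a b p -> is_path e b a (rev p).
Proof.
  rewrite !is_path_ends. intros (N & C & [l E] & [l' E']). repeat split.
  - now apply NoDup_rev.
  - now apply chain_rev.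
  - exists (rev l'). now rewrite E', rev_app_distr.
  - exists (rev l). now rewrite E.
Qed.

(* Two paths that part at [a] close up to a cycle through [a]. *)
Lemma no_detour_around_vertex a x y :
  acyclic e -> e a x -> e a y -> x <> y -> ~ reach (fun z => z <> a) x y.
Proof.
  intros ac ax ay xy R. destruct (reach_path R) as (p & Hp & Ha).
  assert (C : is_path e a y (a :: p)).
  { apply path_cons with x; auto. intros H; now apply (Ha a H). }
  apply (ac (a :: p)). repeat split; try apply C.
  - destruct (path_head Hp) as [[|z l] ->]; simpl; [|lia].
    apply path_last_in in Hp as [|[]]; contradiction.
  - exists a, y. repeat split; auto. apply C.
Qed.

Lemma acyclic_path_unique a b p q :
  acyclic e -> is_path e a b p -> is_path e a b q -> p = q.
Proof.
  intros ac; revert a q; induction p as [|a' p IH]; intros a q Hp Hq.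
  - destruct (path_head Hp); discriminate.
  - destruct (path_head Hp) as [l E]; injection E as -> <-.
    destruct (path_head Hq) as [q' ->].
    destruct p as [|x p]; [apply path_last_in in Hp as [->|[]]; now apply path_loop in Hq|].
    destruct q' as [|y q']; [apply path_last_in in Hq as [->|[]]; now apply path_loop in Hp|].
    pose proof (path_suffix [a] x p Hp) as Px. pose proof (path_suffix [a] y q' Hq) as Py.
    f_equal. destruct (classic (x = y)) as [->|xy]; [now apply IH with y|].
    destruct Hp as (Np & [ax _] & _), Hq as (Nq & [ay _] & _).
    inversion_clear Np as [|? ? Nx _]. inversion_clear Nq as [|? ? Ny _].
    elim (no_detour_around_vertex ac ax ay xy). apply reach_trans with b.
    + apply path_reach with (x :: p); auto. now intros z Hz ->.
    + apply reach_sym. apply path_reach with (y :: q'); auto. now intros z Hz ->.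
Qed.

End Walks.

(** * Subdivided cliques from infinitely connected sets *)

Section Cliques.
Variable V : Type.
Variable adj : V -> V -> Prop.

Definition clique_vertices (P : nat -> nat -> list V) (x : V) : Prop :=
  exists i j, i < j /\ In x (P i j).

Definition avoiding_path (F : list V) (x y : V) (p : list V) : Prop :=
  is_path adj x y p /\ forall z, In z p -> In z F -> z = x \/ z = y.

Definition infinitely_connected (X : V -> Prop) : Prop :=
  forall x y F, X x -> X y -> x <> y -> exists p, avoiding_path F x y p.

Definition vertices_before (f : nat -> V * list V) (n : nat) : list V :=
  flat_map (fun k => fst (f k) :: snd (f k)) (seq 0 n).

Lemma branch_vertex_before f k n : k < n -> In (fst (f k)) (vertices_before f n).
Proof.
  intros Hk. apply in_flat_map. exists k; split; [apply in_seq; lia|now left].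
Qed.

Lemma path_vertex_before f k n z : k < n -> In z (snd (f k)) -> In z (vertices_before f n).
Proof.
  intros Hk Hz. apply in_flat_map. exists k; split; [apply in_seq; lia|now right].
Qed.

Lemma vertices_before_ext f g n :
  (forall k, k < n -> f k = g k) -> vertices_before f n = vertices_before g n.
Proof.
  intros E. unfold vertices_before. rewrite !flat_map_concat_map. f_equal.
  apply map_ext_in. intros k Hk. apply in_seq in Hk. rewrite E by lia. easy.
Qed.

(* The [n]-th step adds one branch vertex, and one path between the two earlier branch vertices
   whose indices [n] encodes. *)
Definition clique_step (X : V -> Prop) (n : nat) (f : nat -> V * list V) (a : V * list V) : Prop :=
  X (fst a) /\ ~ In (fst a) (snd a ++ vertices_before f n) /\
  forall i j, n = to_nat (i, j) -> i < j ->
    avoiding_path (vertices_before f n) (fst (f i)) (fst (f j)) (snd a).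

Lemma lt_to_nat i j : i < j -> j < to_nat (i, j).
Proof. intros Hij. pose proof (to_nat_spec i j). nia. Qed.

Lemma clique_step_local X n f g a :
  (forall k, k < n -> f k = g k) -> clique_step X n f a -> clique_step X n g a.
Proof.
  intros E (Xa & fresh & link). unfold clique_step. rewrite <- (vertices_before_ext _ _ E).
  split; [exact Xa|split; [exact fresh|]]. intros i j -> Hij.
  pose proof (lt_to_nat Hij). rewrite <- !E by lia. now apply link.
Qed.

Lemma clique_step_exists X n f :
  infinite X -> infinitely_connected X ->
  (forall k, k < n -> clique_step X k f (f k)) -> exists a, clique_step X n f a.
Proof.
  intros inf conn Hf.
  assert (Hp : exists p, forall i j, n = to_nat (i, j) -> i < j ->
    avoiding_path (vertices_before f n) (fst (f i)) (fst (f j)) p).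
  { destruct (of_nat n) as [i j] eqn:E.
    assert (code : forall k l, n = to_nat (k, l) -> (k, l) = (i, j)).
    { intros k l ->. now rewrite <- E, cancel_of_to. }
    destruct (classic (i < j)) as [Hij|Hij].
    2: { exists []. intros k l [= -> ->]%code Hkl. contradiction. }
    assert (Hj : j < n) by (rewrite <- (cancel_to_of n), E; now apply lt_to_nat).
    destruct (Hf j Hj) as (Xj & fresh & _). destruct (Hf i) as (Xi & _); [lia|].
    destruct (conn (fst (f i)) (fst (f j)) (vertices_before f n) Xi Xj) as [p Hp].
    { intros Eij. apply fresh. apply in_or_app; right. rewrite <- Eij.
      now apply branch_vertex_before. }
    exists p. now intros k l [= -> ->]%code _. }
  destruct Hp as [p Hp]. destruct (inf (p ++ vertices_before f n)) as (y & Xy & Hy).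
  now exists (y, p).
Qed.

Section CliqueSequence.
Variables (X : V -> Prop) (f : nat -> V * list V).
Hypothesis f_step : forall n, clique_step X n f (f n).
Let b i := fst (f i).
Let P i j := snd (f (to_nat (i, j))).

Lemma clique_path i j : i < j -> is_path adj (b i) (b j) (P i j).
Proof.
  intros Hij. destruct (f_step (to_nat (i, j))) as (_ & _ & link). now apply link.
Qed.

Lemma branch_vertex_inj : Injective b.
Proof.
  assert (lt_neq : forall i j, i < j -> b i <> b j).
  { intros i j Hij E. destruct (f_step j) as (_ & fresh & _). apply fresh.
    apply in_or_app; right. fold (b j). rewrite <- E. now apply branch_vertex_before. }
  intros i j E. destruct (lt_eq_lt_dec i j) as [[Hij|]|Hij]; auto;
    now elim (lt_neq _ _ Hij).
Qed.

Lemma branch_vertex_on_path i j m : i < j -> In (b m) (P i j) -> m = i \/ m = j.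
Proof.
  intros Hij Hm. destruct (f_step m) as (_ & fresh & _).
  destruct (lt_eq_lt_dec m (to_nat (i, j))) as [[H|E]|H].
  - destruct (f_step (to_nat (i, j))) as (_ & _ & link).
    destruct (link i j eq_refl Hij) as [_ only_ends].
    destruct (only_ends (b m)) as [E|E]; auto; [now apply branch_vertex_before| |];
      apply branch_vertex_inj in E; auto.
  - elim fresh. apply in_or_app; left. now rewrite E at 2.
  - elim fresh. apply in_or_app; right. now apply path_vertex_before with (to_nat (i, j)).
Qed.

Lemma clique_paths_meet_in_ends i j k l x :
  i < j -> k < l -> (i, j) <> (k, l) -> In x (P i j) -> In x (P k l) ->
  (x = b i \/ x = b j) /\ (x = b k \/ x = b l).
Proof.
  assert (ordered : forall i j k l, i < j -> k < l -> to_nat (i, j) < to_nat (k, l) ->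
    In x (P i j) -> In x (P k l) -> (x = b i \/ x = b j) /\ (x = b k \/ x = b l)).
  { clear i j k l; intros i j k l Hij Hkl Hlt xij xkl.
    destruct (f_step (to_nat (k, l))) as (_ & _ & link).
    destruct (link k l eq_refl Hkl) as [_ only_ends].
    assert (Hx : x = b k \/ x = b l)
      by (apply only_ends; auto; now apply path_vertex_before with (to_nat (i, j))).
    split; [|exact Hx]. destruct Hx as [-> | ->];
      apply branch_vertex_on_path in xij as [->| ->]; auto. }
  intros Hij Hkl ne xij xkl.
  destruct (lt_eq_lt_dec (to_nat (i, j)) (to_nat (k, l))) as [[H|E]|H].
  - now apply ordered.
  - elim ne. now rewrite <- (cancel_of_to (i, j)), E, cancel_of_to.
  - now apply and_comm, ordered.
Qed.

Lemma clique_sequence_subdivision : subdivided_inf_clique adj (clique_vertices P).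
Proof.
  exists b, P. split; [exact branch_vertex_inj|split; [|split; [|split]]].
  - exact clique_path.
  - exact branch_vertex_on_path.
  - exact clique_paths_meet_in_ends.
  - easy.
Qed.

Lemma clique_sequence_infinite : infinite (fun x => X x /\ clique_vertices P x).
Proof.
  intros l. destruct (Injective_range_infinite branch_vertex_inj l) as (x & [i ->] & fresh).
  exists (b i). split; [split|exact fresh]; [apply f_step|].
  exists i, (S i); split; auto.
  apply path_head_in with adj (b (S i)). apply clique_path; auto.
Qed.

End CliqueSequence.

Lemma infinitely_connected_clique (X : V -> Prop) :
  infinite X -> infinitely_connected X ->
  exists K, subdivided_inf_clique adj K /\ infinite (fun x => X x /\ K x).
Proof.
  intros inf conn. destruct (inf []) as (x0 & _).
  destruct (course_of_values_choice (x0, []) (clique_step X)) as [f Hf].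
  - exact (@clique_step_local X).
  - intros n f. now apply clique_step_exists.
  - eexists. split; [apply (clique_sequence_subdivision Hf)|apply (clique_sequence_infinite Hf)].
Qed.

End Cliques.

(** * The tree-order *)

Section Trees.
Variable V : Type.
Variable adj : V -> V -> Prop.

(* A tree rooted at [r] is given by the map [anc] sending each of its vertices [v] to the list
   [v; ...; r] of the vertices below [v], and every other vertex to the empty list. Thus
   [In u (anc v)] is the tree-order. *)
Definition in_tree (anc : V -> list V) (v : V) : Prop := anc v <> [].

Definition parent (anc : V -> list V) (u v : V) : Prop :=
  in_tree anc u /\ anc v = v :: anc u.

Definition tree (r : V) (anc : V -> list V) : Prop :=
  anc r = [r] /\
  forall v, in_tree anc v -> v = r \/ exists u, adj v u /\ parent anc u v.

Definition comparable (anc : V -> list V) (u v : V) : Prop :=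
  In u (anc v) \/ In v (anc u).

Definition normal (anc : V -> list V) : Prop :=
  forall u v, in_tree anc u -> in_tree anc v -> adj u v -> comparable anc u v.

Definition spanning_order (r : V) (anc : V -> list V) : Prop :=
  tree r anc /\ normal anc /\ forall v, in_tree anc v.

Lemma in_tree_of_below (anc : V -> list V) u v : In u (anc v) -> in_tree anc v.
Proof. unfold in_tree. intros H E. now rewrite E in H. Qed.

Section TreeOrder.
Variables (r : V) (anc : V -> list V).
Hypothesis anc_tree : tree r anc.

Lemma tree_ind (Q : V -> Prop) :
  Q r ->
  (forall u v, adj v u -> parent anc u v -> Q u -> Q v) ->
  forall v, in_tree anc v -> Q v.
Proof.
  intros Qr Qs v. remember (length (anc v)) as n eqn:E. revert v E.
  induction n as [n IH] using lt_wf_ind; intros v -> Hv.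
  destruct (proj2 anc_tree v Hv) as [->|(u & vu & Hu & E)]; auto.
  apply Qs with u; auto; [now split|]. apply (IH (length (anc u))); auto. rewrite E; simpl; lia.
Qed.

Lemma anc_head v : in_tree anc v -> exists l, anc v = v :: l.
Proof.
  intros Hv. destruct (proj2 anc_tree v Hv) as [->|(u & _ & _ & ->)]; eauto.
  exists []; apply anc_tree.
Qed.

Lemma anc_refl v : in_tree anc v -> In v (anc v).
Proof. intros [l ->]%anc_head; now left. Qed.

Lemma anc_inj u v : in_tree anc u -> anc u = anc v -> u = v.
Proof.
  intros Hu E. destruct (anc_head Hu) as [l Eu].
  destruct (@anc_head v) as [l' Ev]; [unfold in_tree; congruence|congruence].
Qed.

Lemma above_ind (Q : V -> Prop) x :
  (in_tree anc x -> Q x) ->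
  (forall u v, parent anc u v -> In x (anc u) -> Q u -> Q v) ->
  forall v, In x (anc v) -> Q v.
Proof.
  intros Qx Qs v Hx. pose proof (in_tree_of_below _ _ _ Hx) as Hv.
  revert Hx. pattern v; revert v Hv. apply tree_ind.
  - rewrite (proj1 anc_tree). intros [<-|[]]. apply Qx.
    unfold in_tree. now rewrite (proj1 anc_tree).
  - intros u v _ Huv IH Hx. pose proof Huv as [_ E]. rewrite E in Hx. destruct Hx as [<-|Hx].
    + apply Qx. unfold in_tree. now rewrite E.
    + apply Qs with u; auto.
Qed.

Lemma anc_suffix x v : In x (anc v) -> in_tree anc x /\ exists l, anc v = l ++ anc x.
Proof.
  revert v; apply above_ind.
  - intros Hx; split; [exact Hx|now exists []].
  - intros u v [_ E] _ [Hx [l El]]. split; [exact Hx|]. exists (v :: l). now rewrite E, El.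
Qed.

Lemma anc_trans x y v : In x (anc y) -> In y (anc v) -> In x (anc v).
Proof.
  intros Hx Hy. destruct (anc_suffix _ _ Hy) as [_ [l ->]]. apply in_or_app; now right.
Qed.

Lemma anc_comparable x y v : In x (anc v) -> In y (anc v) -> comparable anc x y.
Proof.
  unfold comparable. revert v.
  apply (above_ind (fun v => In y (anc v) -> In x (anc y) \/ In y (anc x))); [auto|].
  intros u v [_ E] Hx IH. rewrite E. intros [<-|Hy]; auto. left. rewrite E. now right.
Qed.

Lemma anc_length_le x v : In x (anc v) -> length (anc x) <= length (anc v).
Proof. intros [_ [l ->]]%anc_suffix. rewrite length_app; lia. Qed.

Lemma below_level_inj x v : In x (anc v) -> length (anc x) = length (anc v) -> x = v.
Proof.
  intros [Hx [l El]]%anc_suffix E. apply anc_inj; [exact Hx|].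
  rewrite El in *. rewrite length_app in E. destruct l; [easy|simpl in E; lia].
Qed.

Lemma anc_level_inj x y v :
  In x (anc v) -> In y (anc v) -> length (anc x) = length (anc y) -> x = y.
Proof.
  intros Hx Hy E. destruct (anc_comparable _ _ _ Hx Hy); [|symmetry]; now apply below_level_inj.
Qed.

Lemma parent_not_above u v : parent anc u v -> ~ In v (anc u).
Proof. intros [_ E] H%anc_length_le. rewrite E in H; simpl in H; lia. Qed.

Lemma parent_unique u u' v : parent anc u v -> parent anc u' v -> u = u'.
Proof. intros [Hu E] [_ E']. apply anc_inj; [exact Hu|congruence]. Qed.

Lemma root_below v : in_tree anc v -> In r (anc v).
Proof.
  revert v; apply tree_ind.
  - rewrite (proj1 anc_tree); now left.
  - intros u v _ [_ ->] H; now right.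
Qed.

Lemma child_towards x v :
  In x (anc v) -> v <> x -> exists w, parent anc x w /\ In w (anc v).
Proof.
  revert v.
  apply (above_ind (fun v => v <> x -> exists w, parent anc x w /\ In w (anc v))); [easy|].
  intros u v Huv _ IH _. rewrite (proj2 Huv).
  destruct (classic (u = x)) as [->|ux].
  - exists v; split; [exact Huv|now left].
  - destruct (IH ux) as (w & Hw & wu). exists w; split; [exact Hw|now right].
Qed.

Definition tree_edge (x y : V) : Prop := parent anc x y \/ parent anc y x.

Lemma tree_edge_sym x y : tree_edge x y -> tree_edge y x.
Proof. unfold tree_edge; tauto. Qed.

Lemma parent_adj u v : parent anc u v -> adj v u.
Proof.
  intros Huv. destruct (proj2 anc_tree v) as [->|(w & vw & Hw)].
  - unfold in_tree. rewrite (proj2 Huv). easy.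
  - destruct Huv as [Hu E]. rewrite (proj1 anc_tree) in E. injection E as E. now elim Hu.
  - now rewrite (parent_unique Huv Hw).
Qed.

Lemma anc_path v : in_tree anc v -> is_path tree_edge v r (anc v).
Proof.
  revert v; apply tree_ind.
  - rewrite (proj1 anc_tree); apply path_refl.
  - intros u v _ Huv IH. rewrite (proj2 Huv). apply path_cons with u; auto.
    + now right.
    + now apply parent_not_above.
Qed.

(* The only edge that enters the set of vertices above [b] comes from the parent of [b]. *)
Lemma path_from_parent a b p : parent anc a b -> is_path tree_edge a b p -> p = [a; b].
Proof.
  intros Hab Hp. pose proof (parent_not_above Hab) as Hba.
  destruct (path_head Hp) as [[|u l] ->].
  - apply path_last_in in Hp as [->|[]]. elim Hba. now apply anc_refl, Hab.
  - pose proof (path_suffix [a] u l Hp) as Hl. f_equal.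
    destruct (classic (u = b)) as [->|ub]; [now apply path_loop in Hl|exfalso].
    destruct Hp as (N & [au _] & _). inversion_clear N as [|? ? Na _].
    assert (Hbu : ~ In b (anc u)).
    { destruct au as [[_ E]|[_ E]]; intros H.
      - rewrite E in H. destruct H; auto.
      - apply Hba. rewrite E. now right. }
    assert (R : reach tree_edge (fun z => z <> a) u b).
    { apply path_reach with (u :: l); auto. now intros z Hz ->. }
    apply (@reach_invariant _ tree_edge _ (fun z => ~ In b (anc z))) in R; auto.
    + apply R, anc_refl. unfold in_tree. now rewrite (proj2 Hab).
    + intros y z ya za [Hyz|Hyz] Hby Hbz.
      * pose proof Hyz as [_ E]. rewrite E in Hbz. destruct Hbz as [->|]; auto.
        now apply ya, (parent_unique Hyz).
      * apply Hby. rewrite (proj2 Hyz). now right.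
Qed.

Lemma tree_edge_acyclic : acyclic tree_edge.
Proof.
  intros c (Hl & N & C & x & y & Hx & Hy & [Hyx|Hxy]).
  - assert (Hc : is_path tree_edge y x (rev c)).
    { apply path_rev; [exact tree_edge_sym|]. repeat split; auto. }
    apply (path_from_parent Hyx) in Hc. apply (f_equal (@length V)) in Hc.
    rewrite length_rev in Hc. simpl in Hc; lia.
  - assert (Hc : is_path tree_edge x y c) by (repeat split; auto).
    apply (path_from_parent Hxy) in Hc. subst c; simpl in Hl; lia.
Qed.

End TreeOrder.

Hypothesis adj_sym : forall x y, adj x y -> adj y x.

Lemma normal_spanning_tree_of_order r anc :
  spanning_order r anc -> normal_spanning_tree adj (tree_edge anc) r.
Proof.
  intros (anc_tree & anc_normal & total).
  assert (to_root : forall v, is_path (tree_edge anc) v r (anc v))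
    by (intros v; now apply anc_path).
  assert (from_root : forall v, is_path (tree_edge anc) r v (rev (anc v))).
  { intros v. apply path_rev; [exact (@tree_edge_sym anc)|apply to_root]. }
  split; [split; [|split; [|split]]|].
  - intros x y [H%(parent_adj anc_tree)|H%(parent_adj anc_tree)]; auto.
  - exact (@tree_edge_sym anc).
  - split; [now exists r|]. intros a b.
    destruct (@reach_path _ (tree_edge anc) (fun _ => True) a b) as (p & Hp & _); [|now exists p].
    apply reach_trans with r; eapply path_reach; eauto.
  - exact (tree_edge_acyclic anc_tree).
  - intros x y xy.
    destruct (anc_normal x y (total x) (total y) xy) as [H|H]; [left|right];
      (eexists; split; [apply from_root|now apply in_rev in H]).
Qed.

Lemma order_of_normal_spanning_tree t r :
  normal_spanning_tree adj t r -> exists anc, spanning_order r anc.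
Proof.
  intros ((t_adj & t_sym & t_conn & t_acyclic) & t_normal).
  destruct (choice _ (fun v => proj2 t_conn v r)) as [anc Hanc].
  assert (uniq : forall v p, is_path t v r p -> p = anc v).
  { intros v p Hp. now apply acyclic_path_unique with t v r. }
  assert (total : forall v, in_tree anc v).
  { intros v. unfold in_tree. destruct (path_head (Hanc v)) as [l ->]. easy. }
  assert (below : forall u v, tree_le t r u v -> In u (anc v)).
  { intros u v (p & Hp & Hu). apply path_rev in Hp; [|exact t_sym].
    rewrite <- (uniq v _ Hp). now apply in_rev in Hu. }
  exists anc. split; [split|split; [|exact total]].
  - now apply path_loop with t.
  - intros v _. pose proof (Hanc v) as Hv. destruct (path_head Hv) as [[|u l] E]; rewrite E in Hv.
    + left. now apply path_last_in in Hv as [|[]].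
    + right. exists u. destruct Hv as (N & [vu C] & Hv). split; [now apply t_adj|].
      split; [apply total|]. rewrite E. f_equal. apply uniq.
      apply path_suffix with v [v]. now repeat split.
  - intros x y _ _ xy. destruct (t_normal x y xy); [left|right]; auto.
Qed.

End Trees.

(** * Levels of a normal spanning tree are dispersed *)

Section Levels.
Variable V : Type.
Variable adj : V -> V -> Prop.
Hypothesis adj_sym : forall x y, adj x y -> adj y x.
Variables (b : nat -> V) (P : nat -> nat -> list V).
Hypothesis b_inj : Injective b.
Hypothesis P_path : forall i j, i < j -> is_path adj (b i) (b j) (P i j).
Hypothesis P_disjoint : forall i j k l x, i < j -> k < l -> (i, j) <> (k, l) ->
  In x (P i j) -> In x (P k l) -> (x = b i \/ x = b j) /\ (x = b k \/ x = b l).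

Lemma clique_path_through_two i j k l s t :
  i < j -> k < l -> s <> t -> In s (P i j) -> In t (P i j) -> In s (P k l) -> In t (P k l) ->
  (i, j) = (k, l).
Proof.
  intros Hij Hkl st sij tij skl tkl. apply NNPP; intros ne.
  destruct (P_disjoint s Hij Hkl ne sij skl) as [[Es|Es] [Es'|Es']];
    destruct (P_disjoint t Hij Hkl ne tij tkl) as [[Et|Et] [Et'|Et']]; try congruence;
    rewrite Es in Es'; rewrite Et in Et'; apply b_inj in Es', Et'; try congruence; lia.
Qed.

Lemma clique_paths_meeting_twice_finite (l : list V) :
  exists F, forall s t v i j, s <> t -> In s l -> In t l -> i < j ->
    In s (P i j) -> In t (P i j) -> In v (P i j) -> In v F.
Proof.
  destruct (@finite_cover V (V * V) (fun st v => fst st <> snd st /\ exists i j, i < j /\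
      (In (fst st) (P i j) /\ In (snd st) (P i j)) /\ In v (P i j)))
    with (L := list_prod l l) as [F HF].
  { intros [s t]. simpl.
    destruct (classic (s <> t /\ exists i j, i < j /\ In s (P i j) /\ In t (P i j)))
      as [(st & i & j & Hij & sij & tij)|H].
    - exists (P i j). intros v (_ & k & m & Hkm & [skm tkm] & Hv).
      assert (E : (i, j) = (k, m)) by now apply clique_path_through_two with s t.
      now injection E as -> ->.
    - exists []. intros v (st & k & m & Hkm & Hst & _). apply H; eauto. }
  exists F. intros s t v i j st sl tl Hij sij tij Hv.
  apply (HF (s, t)); [now apply in_prod|]. split; [exact st|]. now exists i, j.
Qed.

Lemma clique_paths_eventually_avoid i F :
  ~ In (b i) F -> exists N, forall n s, N <= n -> In s F -> i < n -> ~ In s (P i n).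
Proof.
  intros Hi. apply (eventually_forall_in (fun n s => i < n -> ~ In s (P i n))).
  intros s Hs. assert (si : s <> b i) by (now intros ->).
  destruct (classic (exists k, i < k /\ In s (P i k))) as [(k & ik & sk)|H].
  - exists (S k); intros n Hn Hin sn.
    assert (E : (i, k) = (i, n)); [|injection E; lia].
    apply clique_path_through_two with s (b i); auto; eapply path_head_in; eauto.
  - exists 0; intros n _ Hin sn. apply H; eauto.
Qed.

Lemma branch_vertices_reach i j F :
  ~ In (b i) F -> ~ In (b j) F -> reach adj (fun z => ~ In z F) (b i) (b j).
Proof.
  intros Hi Hj.
  destruct (clique_paths_eventually_avoid _ _ Hi) as [N Hi'].
  destruct (clique_paths_eventually_avoid _ _ Hj) as [N' Hj'].
  pose (n := S (N + N' + i + j)).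
  assert (in_lt : i < n) by (unfold n; lia). assert (jn_lt : j < n) by (unfold n; lia).
  apply reach_trans with (b n); [|apply reach_sym; auto].
  - apply path_reach with (P i n); auto. intros z Hz Hs. apply (Hi' n z); auto; unfold n; lia.
  - apply path_reach with (P j n); auto. intros z Hz Hs. apply (Hj' n z); auto; unfold n; lia.
Qed.

Variables (r : V) (anc : V -> list V).
Hypothesis anc_spanning : spanning_order adj r anc.

Lemma reach_stays_above x l a c :
  anc x = x :: l -> reach adj (fun z => ~ In z l) a c -> In x (anc a) -> In x (anc c).
Proof.
  destruct anc_spanning as (anc_tree & anc_normal & total). intros E.
  apply (@reach_invariant _ adj _ (fun z => In x (anc z))). intros u v _ Hv uv xu.
  assert (xv : comparable anc x v).
  { destruct (anc_normal u v (total u) (total v) uv) as [H|H].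
    - left. now apply (anc_trans anc_tree) with u.
    - now apply (anc_comparable anc_tree) with u. }
  destruct xv as [|H]; auto. rewrite E in H. destruct H as [<-|]; [|contradiction].
  now apply (anc_refl anc_tree).
Qed.

Lemma path_crosses_ancestors x a c p :
  comparable anc x a -> ~ In x (anc c) -> is_path adj a c p ->
  exists s, In s p /\ In s (anc x).
Proof.
  destruct anc_spanning as (anc_tree & _ & total). intros [xa|ax] xc Hp.
  - apply NNPP; intros H. apply xc.
    destruct (anc_head anc_tree (total x)) as [l E].
    apply reach_stays_above with l a; auto. apply path_reach with p; auto.
    intros z zp zl. apply H. exists z; split; auto. rewrite E; now right.
  - exists a; split; auto. now apply path_head_in in Hp.
Qed.

Lemma branch_vertices_comparable n :
  exists x, length (anc x) = S n /\ forall i, comparable anc x (b i).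
Proof.
  destruct anc_spanning as (anc_tree & _ & total).
  induction n as [|n (x & level_x & Hx)].
  - exists r; split; [now rewrite (proj1 anc_tree)|].
    intros i; left. now apply (root_below anc_tree).
  - destruct (Injective_range_infinite b_inj (anc x)) as (v & [i ->] & Hi).
    destruct (Hx i) as [xi|]; [|contradiction].
    destruct (child_towards anc_tree xi) as (y & [_ Ey] & yi).
    { intros E; apply Hi; rewrite E. now apply (anc_refl anc_tree). }
    exists y; split; [rewrite Ey; simpl; lia|]. intros j. unfold comparable.
    destruct (classic (In (b j) (anc x))) as [Hj|Hj]; [right; rewrite Ey; now right|left].
    apply reach_stays_above with (anc x) (b i); auto. now apply branch_vertices_reach.
Qed.

Lemma clique_path_meets_ancestors_twice x i j v :
  (forall k, comparable anc x (b k)) -> i < j -> In v (P i j) ->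
  ~ In x (anc v) -> ~ In v (anc x) ->
  exists s t, s <> t /\ (In s (anc x) /\ In t (anc x)) /\ In s (P i j) /\ In t (P i j).
Proof.
  intros Hx Hij Hv xv vx. pose proof (P_path Hij) as Hp.
  apply in_split in Hv as (l & l' & E). rewrite E in Hp |- *.
  destruct (path_crosses_ancestors (Hx i) xv (path_prefix _ _ _ Hp)) as (s & sl & sx).
  destruct (path_crosses_ancestors (Hx j) xv (path_rev adj_sym (path_suffix _ _ _ Hp)))
    as (t & tl & tx).
  apply in_rev in tl. apply in_app_iff in sl as [sl|[->|[]]]; [|contradiction].
  exists s, t. rewrite !in_app_iff. split; auto. intros <-.
  now apply (NoDup_app_disjoint _ _ _ (proj1 Hp) sl).
Qed.

Lemma level_separated n :
  exists F, separates adj F (fun v => length (anc v) = n) (clique_vertices P).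
Proof.
  destruct (branch_vertices_comparable n) as (x & level_x & Hx).
  destruct (clique_paths_meeting_twice_finite (anc x)) as [F HF].
  exists (anc x ++ F). intros a v p Ha (i & j & Hij & Hv) Hp.
  assert (Hvp : In v p) by now apply path_last_in in Hp.
  destruct (classic (In v (anc x))) as [vx|vx]; [exists v; rewrite in_app_iff; auto|].
  destruct (classic (In x (anc v))) as [xv|xv].
  - destruct (@path_crosses_ancestors x v a (rev p)) as (s & sp & sx).
    + now left.
    + intros xa%(anc_length_le (proj1 anc_spanning)). lia.
    + now apply path_rev.
    + exists s. rewrite in_app_iff. apply in_rev in sp; auto.
  - destruct (@clique_path_meets_ancestors_twice x i j v Hx Hij Hv xv vx)
      as (s & t & st & [sx tx] & sij & tij).
    exists v. split; auto. apply in_or_app; right. now apply (HF s t v i j).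
Qed.

End Levels.

Lemma levels_dispersed V (adj : V -> V -> Prop) r anc n :
  (forall x y, adj x y -> adj y x) -> spanning_order adj r anc ->
  TK_dispersed adj (fun v => length (anc v) = n).
Proof.
  intros adj_sym anc_spanning K (b & P & b_inj & P_path & _ & P_disjoint & HK).
  destruct (level_separated adj_sym P b_inj P_path P_disjoint anc_spanning n) as [F HF].
  exists F. intros a v p Ha Hv. apply HF; [exact Ha|now apply HK].
Qed.

(** * Growing a normal tree into the components of its complement *)

Section Extension.
Variable V : Type.
Variable adj : V -> V -> Prop.
Hypothesis adj_sym : forall x y, adj x y -> adj y x.
Variable r : V.

Definition component (anc : V -> list V) (v : V) : V -> Prop :=
  reach adj (fun z => anc z = []) v.

Lemma component_eq anc u v : component anc u v -> component anc u = component anc v.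
Proof.
  intros uv. apply functional_extensionality; intros w. apply propositional_extensionality.
  split; intros Hw.
  - apply reach_trans with u; auto. now apply reach_sym.
  - now apply reach_trans with v.
Qed.

Record top_neighbour (anc : V -> list V) (D : V -> Prop) (t : V) : Prop := {
  top_in_tree : in_tree anc t;
  top_adjacent : exists y, D y /\ adj y t;
  top_above : forall y x, D y -> in_tree anc x -> adj y x -> In x (anc t)
}.

Record extendable (anc : V -> list V) : Prop := {
  extendable_tree : tree adj r anc;
  extendable_normal : normal adj anc;
  extendable_top : forall v, anc v = [] -> exists t, top_neighbour anc (component anc v) t
}.

(* [Q] lists, from top to bottom, a path to be grown in [D] from the tree vertex [t]. *)
Record branch (anc : V -> list V) (A D : V -> Prop) (Q : list V) (t : V) : Prop := {
  branch_top : top_neighbour anc D t;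
  branch_nonempty : Q <> [];
  branch_NoDup : NoDup Q;
  branch_inside : forall q, In q Q -> D q;
  branch_chain : chain adj (Q ++ [t]);
  branch_target : (exists a, D a /\ A a) -> exists a, In a Q /\ A a
}.

Lemma branch_exists anc A v :
  extendable anc -> anc v = [] -> exists Q t, branch anc A (component anc v) Q t.
Proof.
  intros ext Hv. destruct (extendable_top ext v Hv) as [t Ht].
  destruct (top_adjacent Ht) as (y & vy & yt).
  assert (start : exists a, component anc v a /\ ((exists a, component anc v a /\ A a) -> A a)).
  { destruct (classic (exists a, component anc v a /\ A a)) as [(a & va & Aa)|];
      [exists a|exists y]; tauto. }
  destruct start as (a & va & Aa).
  destruct (@reach_path _ adj (fun z => anc z = []) a y) as (p & Hp & outside).
  { apply reach_trans with v; auto. now apply reach_sym. }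
  pose proof (path_head_in Hp) as ap.
  pose proof Hp as (N & C & [l E] & [l' E'])%is_path_ends.
  exists p, t. split; auto.
  - now rewrite E.
  - intros q Hq. apply reach_trans with a; auto. subst p. now apply chain_reach with l.
  - rewrite E', <- app_assoc. apply chain_app; [now rewrite <- E'|now split].
  - intros H. exists a; auto.
Qed.

Fixpoint suffix_from (v : V) (l : list V) : list V :=
  match l with
  | [] => []
  | x :: l' => if excluded_middle_informative (x = v) then l else suffix_from v l'
  end.

Lemma suffix_from_notin v l : ~ In v l -> suffix_from v l = [].
Proof.
  induction l as [|x l IH]; simpl; auto; intros H.
  destruct (excluded_middle_informative (x = v)); tauto.
Qed.

Lemma suffix_from_app v l l' : ~ In v l -> suffix_from v (l ++ v :: l') = v :: l'.
Proof.
  induction l as [|x l IH]; simpl; intros H;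
    destruct (excluded_middle_informative _); tauto.
Qed.

(* The choice depends on the component only, so all its vertices agree on the branch. *)
Definition chosen_branch (anc : V -> list V) (A D : V -> Prop) : list V * V :=
  epsilon (inhabits ([], r)) (fun Qt => branch anc A D (fst Qt) (snd Qt)).

Lemma chosen_branch_spec anc A D :
  (exists Q t, branch anc A D Q t) ->
  branch anc A D (fst (chosen_branch anc A D)) (snd (chosen_branch anc A D)).
Proof.
  intros (Q & t & HQ). unfold chosen_branch. apply epsilon_spec. now exists (Q, t).
Qed.

Definition extend (A : V -> Prop) (anc : V -> list V) (v : V) : list V :=
  match anc v with
  | [] => let (Q, t) := chosen_branch anc A (component anc v) in suffix_from v (Q ++ anc t)
  | l => l
  end.

Section Step.
Variables (A : V -> Prop) (anc : V -> list V).
Hypothesis anc_ext : extendable anc.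
Let anc' := extend A anc.

Lemma extend_old v : in_tree anc v -> anc' v = anc v.
Proof. unfold anc', extend, in_tree; now destruct (anc v). Qed.

Lemma in_tree_extend v : in_tree anc v -> in_tree anc' v.
Proof. intros Hv. unfold in_tree. now rewrite extend_old. Qed.

Lemma extend_nil v : anc' v = [] -> anc v = [].
Proof. unfold anc', extend; now destruct (anc v). Qed.

Lemma component_extend v w : component anc' v w -> component anc v w.
Proof. apply reach_sub. exact extend_nil. Qed.

Lemma extend_component v : anc v = [] ->
  exists Q t, branch anc A (component anc v) Q t /\
    (forall q, In q Q <-> component anc v q /\ in_tree anc' q) /\
    (forall l q l', Q = l ++ q :: l' -> anc' q = q :: l' ++ anc t).
Proof.
  intros Hv. pose proof (chosen_branch_spec (branch_exists A v anc_ext Hv)) as HQ.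
  destruct (chosen_branch anc A (component anc v)) as [Q t] eqn:E; simpl in HQ.
  exists Q, t; split; auto.
  assert (anc'_eq : forall q, component anc v q -> anc' q = suffix_from q (Q ++ anc t)).
  { intros q vq. unfold anc', extend. rewrite (reach_right vq).
    now rewrite <- (component_eq vq), E. }
  assert (anc'_split : forall l q l', Q = l ++ q :: l' -> anc' q = q :: l' ++ anc t).
  { intros l q l' EQ. rewrite anc'_eq by (apply (branch_inside HQ); rewrite EQ; apply in_elt).
    pose proof (branch_NoDup HQ) as N. rewrite EQ in N |- *.
    rewrite <- app_assoc. apply suffix_from_app. apply NoDup_remove_2 in N.
    rewrite in_app_iff in N; auto. }
  split; auto. intros q; split.
  - intros Hq; split; [now apply (branch_inside HQ)|]. unfold in_tree.
    apply in_split in Hq as (l & l' & EQ). now rewrite (anc'_split l q l' EQ).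
  - intros [vq Hq]. apply NNPP; intros Hn. apply Hq. rewrite anc'_eq; auto.
    apply suffix_from_notin. intros [H|H]%in_app_iff; auto.
    destruct (anc_suffix (extendable_tree anc_ext) _ _ H) as [Hne _].
    apply Hne. now apply reach_right in vq.
Qed.

Lemma extend_new v : anc v = [] -> in_tree anc' v ->
  exists l l' t, branch anc A (component anc v) (l ++ v :: l') t /\
    anc' v = v :: l' ++ anc t /\
    forall u l'', l' = u :: l'' -> anc' u = u :: l'' ++ anc t.
Proof.
  intros Hv Hv'. destruct (extend_component Hv) as (Q & t & HQ & vertices & anc'_split).
  assert (vQ : In v Q) by (apply vertices; split; auto; now apply reach_refl).
  apply in_split in vQ as (l & l' & ->). exists l, l', t. split; [exact HQ|split].
  - now apply (anc'_split l).
  - intros u l'' ->. apply (anc'_split (l ++ [v])). now rewrite <- app_assoc.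
Qed.

Lemma extend_tree : tree adj r anc'.
Proof.
  pose proof (extendable_tree anc_ext) as anc_tree. split.
  - rewrite extend_old; [apply anc_tree|]. unfold in_tree. now rewrite (proj1 anc_tree).
  - intros v Hv. destruct (classic (anc v = [])) as [out|out].
    + right. destruct (extend_new out Hv) as (l & l' & t & HQ & Ev & Eu).
      pose proof (branch_chain HQ) as C. rewrite <- app_assoc in C. apply chain_app_r in C.
      destruct l' as [|u l'].
      * pose proof (top_in_tree (branch_top HQ)) as Ht.
        exists t. split; [apply C|]. split; [now apply in_tree_extend|].
        now rewrite (extend_old Ht).
      * exists u. split; [apply C|]. specialize (Eu u l' eq_refl).
        split; [unfold in_tree; now rewrite Eu|]. now rewrite Ev, Eu.
    + destruct (proj2 anc_tree v out) as [|(u & vu & Hu & E)]; auto. right.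
      exists u. split; [exact vu|]. split; [now apply in_tree_extend|].
      now rewrite !extend_old.
Qed.

Lemma extend_normal : normal adj anc'.
Proof.
  assert (new_old : forall u v, in_tree anc' u -> anc u = [] -> in_tree anc v -> adj u v ->
    In v (anc' u)).
  { intros u v Hu out Hv uv. destruct (extend_new out Hu) as (l & l' & t & HQ & -> & _).
    right. apply in_or_app; right. apply (top_above (branch_top HQ)) with u; auto.
    now apply reach_refl. }
  intros u v Hu Hv uv. unfold comparable.
  destruct (classic (anc u = [])) as [out_u|in_u], (classic (anc v = [])) as [out_v|in_v]; auto.
  - destruct (extend_component out_u) as (Q & t & _ & vertices & anc'_split).
    assert (uu : component anc u u) by now apply reach_refl.
    assert (uQ : In u Q) by now apply vertices.
    assert (vQ : In v Q) by (apply vertices; split; auto; now apply reach_snoc with u).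
    destruct (split_order Q u v uQ vQ) as [(l & l' & E & H)|(l & l' & E & H)]; [right|left];
      rewrite (anc'_split _ _ _ E); apply (in_or_app (_ :: l')); now left.
  - rewrite !extend_old by auto. now apply (extendable_normal anc_ext).
Qed.

Lemma extend_meets_component v :
  anc' v = [] ->
  exists y q, component anc' v y /\ adj y q /\ component anc v q /\ in_tree anc' q.
Proof.
  intros Hv. destruct (extend_component (extend_nil _ Hv)) as (Q & t & HQ & vertices & _).
  destruct Q as [|q Q]; [now elim (branch_nonempty HQ)|].
  destruct (proj1 (vertices q) (or_introl eq_refl)) as [vq Hq].
  destruct (reach_exit (fun z => anc' z = []) vq Hv Hq) as (y & z & vy & yz & out & Hz).
  exists y, z. repeat split; auto.
  - revert vy; apply reach_sub; tauto.
  - apply reach_snoc with y; auto. revert vy; apply reach_sub; tauto.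
Qed.

(* The first vertex of the grown path with a neighbour in the new component is its top neighbour. *)
Lemma extend_top v : anc' v = [] -> exists t, top_neighbour anc' (component anc' v) t.
Proof.
  intros Hv. destruct (extend_component (extend_nil _ Hv)) as (Q & t & HQ & vertices & anc'_split).
  destruct (split_first (fun q => exists y, component anc' v y /\ adj y q) Q)
    as (l & q & l' & E & Hq & first).
  { destruct (extend_meets_component _ Hv) as (y & q & vy & yq & vq & Hq).
    exists q; split; [now apply vertices|eauto]. }
  pose proof (anc'_split _ _ _ E) as Eq.
  exists q. split; [unfold in_tree; now rewrite Eq|exact Hq|].
  intros y x vy Hx yx. rewrite Eq. pose proof (component_extend vy) as vy'.
  destruct (classic (anc x = [])) as [out|in_x].
  - assert (xQ : In x Q) by (apply vertices; split; auto; now apply reach_snoc with y).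
    rewrite E in xQ. apply in_app_iff in xQ as [xl|xl']; [elim (first x xl); eauto|].
    apply (in_or_app (q :: l')); now left.
  - right. apply in_or_app; right. now apply (top_above (branch_top HQ)) with y.
Qed.

Lemma extend_extendable : extendable anc'.
Proof. split; [exact extend_tree|exact extend_normal|exact extend_top]. Qed.

End Step.
End Extension.

(** * Iterated growth *)

Section Stages.
Variable V : Type.
Variable adj : V -> V -> Prop.
Hypothesis adj_sym : forall x y, adj x y -> adj y x.
Hypothesis G_conn : connected adj.
Variable r : V.
Variable aim : nat -> (V -> list V) -> V -> Prop.

Fixpoint stage (n : nat) : V -> list V :=
  match n with
  | O => fun v => if excluded_middle_informative (v = r) then [r] else []
  | S n => extend adj r (aim n (stage n)) (stage n)
  end.

Lemma stage0_root : stage 0 r = [r].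
Proof. simpl; now destruct (excluded_middle_informative (r = r)). Qed.

Lemma stage0_in_tree v : in_tree (stage 0) v -> v = r.
Proof. unfold in_tree; simpl; now destruct (excluded_middle_informative (v = r)). Qed.

Lemma stage0_extendable : extendable adj r (stage 0).
Proof.
  assert (r_in : in_tree (stage 0) r) by (unfold in_tree; now rewrite stage0_root).
  split.
  - split; [exact stage0_root|]. intros v Hv; left; now apply stage0_in_tree.
  - intros u v Hu%stage0_in_tree Hv%stage0_in_tree _. subst.
    left. rewrite stage0_root; now left.
  - intros v Hv. exists r. split; [exact r_in| |].
    + destruct (proj2 G_conn v r) as [p Hp].
      assert (R : reach adj (fun _ => True) v r) by (eapply path_reach; eauto).
      destruct (reach_exit (fun z => stage 0 z = []) R Hv r_in) as (y & z & vy & yz & _ & Hz).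
      apply stage0_in_tree in Hz; subst z. exists y; split; auto.
      revert vy; apply reach_sub; tauto.
    + intros y x _ Hx%stage0_in_tree _. subst. rewrite stage0_root; now left.
Qed.

Lemma stage_extendable n : extendable adj r (stage n).
Proof.
  induction n as [|n IH]; [exact stage0_extendable|now apply extend_extendable].
Qed.

Lemma stage_mono n m v : n <= m -> in_tree (stage n) v -> stage m v = stage n v.
Proof.
  induction 1 as [|m _ IH]; auto; intros Hv.
  rewrite <- IH; auto. apply extend_old. unfold in_tree. now rewrite IH.
Qed.

Definition covered (v : V) : Prop := exists n, in_tree (stage n) v.

Lemma uncovered_nil v n : ~ covered v -> stage n v = [].
Proof. intros H. apply NNPP; intros Hn; apply H; now exists n. Qed.

Lemma stage_limit : (forall v, covered v) -> exists anc, spanning_order adj r anc.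
Proof.
  intros tot. destruct (choice _ tot) as [h Hh].
  pose (anc := fun v => stage (h v) v).
  assert (anc_eq : forall n v, in_tree (stage n) v -> stage n v = anc v).
  { intros n v Hv. destruct (le_ge_dec n (h v)) as [H|H].
    - symmetry; now apply stage_mono.
    - now apply stage_mono. }
  exists anc. split; [split|split; [|exact Hh]].
  - rewrite <- (anc_eq 0); [exact stage0_root|]. unfold in_tree. now rewrite stage0_root.
  - intros v _.
    destruct (proj2 (extendable_tree (stage_extendable (h v))) v (Hh v))
      as [|(u & vu & Hu & E)]; auto.
    right; exists u. split; [exact vu|]. split; [apply Hh|]. unfold anc at 1. rewrite E.
    f_equal. now apply anc_eq.
  - intros u v _ _ uv. pose (n := h u + h v).
    assert (Eu : stage n u = anc u) by (apply stage_mono; auto; unfold n; lia).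
    assert (Ev : stage n v = anc v) by (apply stage_mono; auto; unfold n; lia).
    unfold comparable. rewrite <- Eu, <- Ev.
    apply (extendable_normal (stage_extendable n)); auto; unfold in_tree;
      rewrite ?Eu, ?Ev; apply Hh.
Qed.

Definition recurrent (A : (V -> list V) -> V -> Prop) : Prop :=
  forall N, exists n, N <= n /\ aim n = A.

Definition level_neighbour (k : nat) (anc : V -> list V) (a : V) : Prop :=
  exists x, adj a x /\ in_tree anc x /\ length (anc x) = k.

Section Uncovered.
Variable c : V.
Hypothesis c_uncovered : ~ covered c.

Definition grown (n : nat) (q : V) : Prop :=
  component adj (stage n) c q /\ in_tree (stage (S n)) q.

Lemma grown_branch n :
  exists Q t, branch adj (stage n) (aim n (stage n)) (component adj (stage n) c) Q t /\
    forall q, In q Q <-> grown n q.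
Proof.
  destruct (extend_component adj_sym (aim n (stage n)) (stage_extendable n) c
    (uncovered_nil n c_uncovered)) as (Q & t & HQ & vertices & _).
  now exists Q, t.
Qed.

Lemma grown_nonempty n : exists q, grown n q.
Proof.
  destruct (grown_branch n) as ([|q Q] & t & HQ & vertices); [now elim (branch_nonempty HQ)|].
  exists q; apply vertices; now left.
Qed.

Lemma grown_connected n q q' : grown n q -> grown n q' -> reach adj (grown n) q q'.
Proof.
  intros Hq Hq'. destruct (grown_branch n) as ([|q0 Q] & t & HQ & vertices);
    [now elim (branch_nonempty HQ)|].
  pose proof (branch_chain HQ) as C. apply chain_app_l in C.
  assert (from_head : forall z, grown n z -> reach adj (grown n) q0 z).
  { intros z Hz. apply chain_reach with Q; auto; [|now apply vertices]. intros w; apply vertices. }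
  apply reach_trans with q0; auto. apply reach_sym; auto.
Qed.

(* The top neighbour at stage [n + 1] lies above a vertex grown at stage [n], whereas below an
   older vertex there are older vertices only. *)
Lemma grown_linked n : exists q q', grown n q /\ grown (S n) q' /\ adj q q'.
Proof.
  destruct (grown_branch (S n)) as (Q & t & HQ & vertices).
  destruct (branch_top HQ) as [t_in (y & cy & yt) above].
  destruct (exists_last (branch_nonempty HQ)) as (Q' & q' & ->).
  pose proof (branch_chain HQ) as C. rewrite <- app_assoc in C. apply chain_app_r in C.
  exists t, q'. split; [split; [|exact t_in]|split].
  - apply reach_snoc with y; auto; [now apply component_extend in cy|].
    apply NNPP; intros t_old.
    destruct (extend_meets_component adj_sym (aim n (stage n)) (stage_extendable n) c
      (uncovered_nil (S n) c_uncovered)) as (z & q & cz & zq & cq & Hq).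
    assert (qt : In q (stage (S n) t)) by now apply above with z.
    rewrite (stage_mono (le_S _ _ (le_n n)) t_old) in qt.
    destruct (anc_suffix (extendable_tree (stage_extendable n)) _ _ qt) as [q_old _].
    apply q_old. now apply reach_right in cq.
  - apply vertices. apply in_elt.
  - apply adj_sym, C.
Qed.

Definition grown_from (N : nat) (q : V) : Prop := exists n, N <= n /\ grown n q.

Lemma grown_from_avoids F : exists N, forall q, grown_from N q -> ~ In q F.
Proof.
  destruct (eventually_forall_in (fun n q => ~ grown n q) F) as [N HN].
  - intros q _. destruct (classic (covered q)) as [[m Hm]|H].
    + exists m; intros n Hn [Hq _]. apply reach_right in Hq.
      rewrite (stage_mono Hn Hm) in Hq. contradiction.
    + exists 0; intros n _ [_ Hq]. apply H. now exists (S n).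
  - exists N. intros q (n & Hn & Hq) HF. now apply (HN n q).
Qed.

Lemma grown_from_connected N q q' :
  grown_from N q -> grown_from N q' -> reach adj (grown_from N) q q'.
Proof.
  assert (same : forall n q q', N <= n -> grown n q -> grown n q' -> reach adj (grown_from N) q q').
  { clear q q'; intros n q q' Hn Hq Hq'.
    apply reach_sub with (grown n); [|now apply grown_connected]. intros z Hz; now exists n. }
  assert (later : forall k n q q', N <= n -> grown n q -> grown (k + n) q' ->
     reach adj (grown_from N) q q').
  { clear q q'; induction k as [|k IH]; intros n q q' Hn Hq Hq'; [now apply same with n|].
    destruct (grown_linked (k + n)) as (z & z' & Hz & Hz' & zz').
    apply reach_trans with z'; [|apply same with (S k + n); auto; lia].
    apply reach_snoc with z; auto; [now apply (IH n)|]. exists (S (k + n)); split; auto; lia. }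
  intros (m & Hm & Hq) (n & Hn & Hq'). destruct (le_ge_dec m n) as [H|H].
  - apply (later (n - m) m); auto. now replace (n - m + m) with n by lia.
  - apply reach_sym; auto. apply (later (m - n) n); auto. now replace (m - n + n) with m by lia.
Qed.

Lemma grown_meets_recurrent A N :
  recurrent A -> (forall n, N <= n -> exists a, component adj (stage n) c a /\ A (stage n) a) ->
  exists n q, N <= n /\ grown n q /\ A (stage n) q.
Proof.
  intros rec Ha. destruct (rec N) as (n & Hn & E).
  destruct (grown_branch n) as (Q & t & HQ & vertices). rewrite E in HQ.
  destruct (branch_target HQ (Ha n Hn)) as (q & qQ & Aq).
  exists n, q. split; [exact Hn|]. split; [now apply vertices|exact Aq].
Qed.

Lemma grown_from_meets A N : recurrent (fun _ => A) -> A c -> exists q, grown_from N q /\ A q.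
Proof.
  intros rec Ac. destruct (@grown_meets_recurrent _ N rec) as (n & q & Hn & Hq & Aq).
  - intros n _. exists c; split; auto. apply reach_refl. now apply uncovered_nil.
  - exists q; split; auto. now exists n.
Qed.

Definition boundary (x : V) : Prop :=
  covered x /\ exists y, reach adj (fun z => ~ covered z) c y /\ adj y x.

Lemma boundary_infinite : infinite boundary.
Proof.
  intros l. apply NNPP; intros no_fresh.
  destruct (eventually_forall_in (fun n x => boundary x -> in_tree (stage n) x) l) as [N HN].
  { intros x _. destruct (classic (covered x)) as [[n Hx]|Hx].
    - exists n. intros m Hm _. unfold in_tree. now rewrite (stage_mono Hm Hx).
    - exists 0. now intros m _ [H _]. }
  destruct (grown_nonempty N) as (q & cq & Hq).
  destruct (reach_exit (fun z => ~ covered z) cq c_uncovered) as (y & z & cy & yz & Hz & z_cov).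
  { intros H; apply H. now exists (S N). }
  assert (bz : boundary z).
  { split; [now apply NNPP|]. exists y; split; auto. revert cy; apply reach_sub; tauto. }
  apply (HN N z); auto. apply NNPP; intros zl; apply no_fresh; now exists z.
Qed.

Hypothesis levels_recurrent : forall k, recurrent (level_neighbour k).

(* All neighbours of a component lie below its top neighbour, so that [x] is the only one of them
   in its level. *)
Lemma boundary_adjacent_grown x N : boundary x -> exists q, grown_from N q /\ adj q x.
Proof.
  intros [[m Hx] (y & cy & yx)].
  assert (later : forall n, N + m <= n -> component adj (stage n) c y /\ stage n x = stage m x).
  { intros n Hn; split; [|apply stage_mono; auto; lia].
    revert cy; apply reach_sub. intros z; apply uncovered_nil. }
  destruct (@grown_meets_recurrent _ (N + m) (levels_recurrent (length (stage m x))))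
    as (n & q & Hn & Hq & x' & qx' & Hx' & El).
  { intros n Hn. destruct (later n Hn) as [cny Ex]. exists y; split; auto.
    exists x. unfold in_tree. now rewrite Ex. }
  exists q. split; [exists n; split; auto; lia|]. replace x with x'; auto.
  destruct (later n Hn) as [cny Ex]. destruct (grown_branch n) as (Q & t & HQ & _).
  apply (anc_level_inj (extendable_tree (stage_extendable n))) with t.
  - apply (top_above (branch_top HQ)) with q; auto. apply Hq.
  - apply (top_above (branch_top HQ)) with y; auto. unfold in_tree. now rewrite Ex.
  - now rewrite Ex.
Qed.

Lemma boundary_infinitely_connected : infinitely_connected adj boundary.
Proof.
  intros x y F Hx Hy _. destruct (grown_from_avoids F) as [N HN].
  destruct (boundary_adjacent_grown N Hx) as (q & Hq & qx).
  destruct (boundary_adjacent_grown N Hy) as (q' & Hq' & qy).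
  apply reach_path. apply reach_cons with q; auto. apply reach_snoc with q'; auto.
  apply reach_sub with (grown_from N); [|now apply grown_from_connected].
  intros z Hz HS. now elim (HN z Hz).
Qed.

Lemma uncovered_not_dispersed A : recurrent (fun _ => A) -> A c -> ~ TK_dispersed adj A.
Proof.
  intros rec Ac disp.
  destruct (infinitely_connected_clique boundary_infinite boundary_infinitely_connected)
    as (K & HK & Kinf).
  destruct (disp K HK) as [F HF]. destruct (Kinf F) as (x & [Hx Kx] & xF).
  destruct (grown_from_avoids F) as [N HN].
  destruct (boundary_adjacent_grown N Hx) as (q & Hq & qx).
  destruct (grown_from_meets N rec Ac) as (a & Ha & Aa).
  destruct (@reach_path _ adj (fun z => ~ In z F) a x) as (p & Hp & avoid).
  { apply reach_snoc with q; auto.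
    apply reach_sub with (grown_from N); [exact HN|now apply grown_from_connected]. }
  destruct (HF a x p Aa Kx Hp) as (z & zF & zp). now apply (avoid z).
Qed.

End Uncovered.
End Stages.

Definition repeating (A : Type) (u : nat -> A) (n : nat) : A := u (fst (of_nat n)).

Lemma repeating_recurrent V (targets : nat -> (V -> list V) -> V -> Prop) m :
  recurrent (repeating targets) (targets m).
Proof.
  intros N. exists (to_nat (m, N)). unfold repeating. rewrite cancel_of_to.
  split; [|easy]. pose proof (to_nat_non_decreasing m N). lia.
Qed.

Lemma spanning_order_of_dispersed V (adj : V -> V -> Prop) r (Vn : nat -> V -> Prop) :
  (forall x y, adj x y -> adj y x) -> connected adj ->
  (forall v, exists n, Vn n v) -> (forall n, TK_dispersed adj (Vn n)) ->
  exists anc, spanning_order adj r anc.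
Proof.
  intros adj_sym G_conn cover disp.
  pose (targets := fun m => match of_nat m with
    | (k, O) => fun _ => Vn k
    | (k, S _) => level_neighbour adj k
    end).
  assert (sets : forall k, targets (to_nat (k, 0)) = fun _ => Vn k)
    by (intros k; unfold targets; now rewrite cancel_of_to).
  assert (levels : forall k, targets (to_nat (k, 1)) = level_neighbour adj k)
    by (intros k; unfold targets; now rewrite cancel_of_to).
  apply (@stage_limit _ adj adj_sym G_conn r (repeating targets)).
  intros v. apply NNPP; intros uncovered. destruct (cover v) as [k Hk].
  apply (uncovered_not_dispersed adj_sym G_conn uncovered) with (Vn k); auto.
  - intros j. rewrite <- levels. apply repeating_recurrent.
  - rewrite <- sets. apply repeating_recurrent.
Qed.

Theorem theorem3 (V : Type) (adj : V -> V -> Prop)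
  (adj_sym : forall x y, adj x y -> adj y x)
  (adj_irrefl : forall x, ~ adj x x)
  (G_conn : connected adj) :
  has_normal_spanning_tree adj <->
  exists Vn : nat -> V -> Prop,
    (forall v, exists n, Vn n v) /\
    (forall n, TK_dispersed adj (Vn n)).
Proof.
  split.
  - intros (t & r & [anc Hanc]%order_of_normal_spanning_tree).
    exists (fun n v => length (anc v) = n). split; [eauto|].
    intros n. now apply levels_dispersed with r.
  - intros (Vn & cover & disp). destruct (proj1 G_conn) as [r _].
    destruct (spanning_order_of_dispersed r Vn adj_sym G_conn cover disp) as [anc Hanc].
    exists (tree_edge anc), r. now apply normal_spanning_tree_of_order.
Qed.
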